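(* Let $(\mathcal{E},\circ)$ be a Euclidean Jordan algebra of rank $r$, let $f:\mathbb{R}^r\to\mathbb{R}$ be a symmetric function, and let $F:\mathcal{E}\to\mathbb{R}$, $F(x)=f(\lambda(x))$, be the corresponding spectral function. Let $x\in\mathcal{E}$. Then: (i) $F$ satisfies the KL property at $x$ if and only if $f$ satisfies the KL property at $\lambda(x)$. In addition, the $\psi$ and $\nu$ in the definition of the KL property can be taken to be the same for both $f$ and $F$. (ii) $F$ satisfies the KL property with exponent $\alpha$ at $x$ if and only if $f$ satisfies the KL property with exponent $\alpha$ at $\lambda(x)$.
   Context: Euclidean Jordan algebras. A Euclidean Jordan algebra $(\mathcal{E},\circ)$ is a finite-dimensional real vector space with a bilinear product $\circ$ and an inner product $\langle\cdot,\cdot\rangle$ such that $x\circ y=y\circ x$, $x\circ(x^2\circ y)=x^2\circ(x\circ y)$ (with $x^2=x\circ x$), and $\langle x\circ y,z\rangle=\langle x,y\circ z\rangle$; it has an identity element $e$. An idempotent is $c$ with $c\circ c=c$; a nonzero idempotent is primitive if it is not a sum of two nonzero idempotents $\hat c,\tilde c$ with $\hat c\circ\tilde c=0$. A Jordan frame is an ordered tuple $J=[c_1,\dots,c_r]$ of primitive idempotents with $c_i\circ c_j=0$ for $i\ne j$ and $c_1+\dots+c_r=e$; all Jordan frames have the same length $r$, the rank of $\mathcal{E}$. By the spectral theorem every $x$ is $\sum_i\alpha_ic_i$ for some Jordan frame, with the real numbers $\alpha_i$ (the eigenvalues of $x$) unique up to order. $\lambda(x)=(\lambda_1(x),\dots,\lambda_r(x))$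 is the vector of eigenvalues in nonincreasing order. $\operatorname{tr}(x)=\sum_i\lambda_i(x)$. The inner product is taken to be $\langle x,y\rangle=\operatorname{tr}(x\circ y)$, with norm $\|x\|=\sqrt{\operatorname{tr}(x^2)}$. $\mathbb{R}^r$ has the usual Euclidean inner product and norm. $f$ is symmetric if $f(Pu)=f(u)$ for all $u\in\mathbb{R}^r$ and all $r\times r$ permutation matrices $P$. Let $V$ be $\mathbb{R}^r$ or $\mathcal{E}$ and $g:V\to\mathbb{R}$. The regular subdifferential $\hat\partial g(u)$ is the set of $d\in V$ with $\liminf_{v\to0,\,v\ne0}\frac{g(u+v)-g(u)-\langle d,v\rangle}{\|v\|}\ge0$. The approximate subdifferential $\partial g(u)$ is the set of $d$ for which there are sequences $u^k\to u$, $d^k\to d$ with $g(u^k)\to g(u)$ and $d^k\in\hat\partial g(u^k)$ for all $k$. $\operatorname{dom}\partial g=\{u\mid\partial g(u)\neq\emptyset\}$. $\operatorname{dist}(u,C)=\inf\{\|v-u\|\mid v\in C\}$ (equal to $+\infty$ if $C=\emptyset$). KL property. A lower semicontinuous function $g$ satisfies the KL property at $u\in\operatorname{dom}\partial g$ if there exist a neighbourhood $U$ of $u$, $\nu\in(0,\infty]$ and a continuous concave function $\psi:[0,\nu)\to\mathbb{R}_+$ with $\psi(0)=0$ such that: (1) $\psi$ is continuously differentiable on $(0,\nu)$ with $\psi'>0$ on $(0,\nu)$; (2) for all $v\in U$ with $g(u)<g(v)<g(u)+\nu$, $\psi'(g(v)-g(u))\operatorname{dist}(0,\partial g(v))\ge1$.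 (The statement ''$g$ satisfies the KL property at $u$'' includes that $g$ is lower semicontinuous and $u\in\operatorname{dom}\partial g$.) It satisfies the KL property with exponent $\alpha$ at $u$ if $\psi$ can be taken to be $\psi(t)=ct^{1-\alpha}$ for some constant $c>0$. *)

(* Defs.v *)
From HB Require Import structures.
From mathcomp Require Import all_boot all_order all_algebra.
From mathcomp Require Import all_classical all_reals all_analysis.

Set Implicit Arguments.
Unset Strict Implicit.
Unset Printing Implicit Defensive.

Import Order.TTheory GRing.Theory Num.Theory.
Import numFieldNormedType.Exports.

Local Open Scope classical_set_scope.
Local Open Scope ring_scope.

Record euclideanJordanAlgebra (R : realType) := EuclideanJordanAlgebra {
  ej_carrier :> vectType R ;
  ej_mul : {bilinear ej_carrier -> ej_carrier -> ej_carrier} ;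
  (* a symmetric positive definite bilinear form *)
  ej_inner : {dot ej_carrier for (@idfun R)} ;
  ej_one : ej_carrier ;
  ej_mulC : forall x y, ej_mul x y = ej_mul y x ;
  ej_jordan : forall x y,
    ej_mul x (ej_mul (ej_mul x x) y) = ej_mul (ej_mul x x) (ej_mul x y) ;
  ej_inner_assoc : forall x y z,
    ej_inner (ej_mul x y) z = ej_inner x (ej_mul y z) ;
  ej_mul1 : forall x, ej_mul ej_one x = x
}.

Section EuclideanJordanAlgebra.
Variables (R : realType) (E : euclideanJordanAlgebra R).
Implicit Types x y c : E.

Definition idempotent_elt c := ej_mul E c c = c.

Definition primitive_idempotent c :=
  [/\ idempotent_elt c, c != 0 &
      ~ exists a b : E, [/\ idempotent_elt a /\ a != 0,
          idempotent_elt b /\ b != 0, ej_mul E a b = 0 & c = a + b]].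

Definition jordan_frame (r : nat) (J : 'I_r -> E) :=
  [/\ forall i, primitive_idempotent (J i),
      forall i j, i != j -> ej_mul E (J i) (J j) = 0 &
      \sum_(i < r) J i = ej_one E].

(* The common length of all Jordan frames. The default value 0 of [xget] is
   irrelevant, since Jordan frames exist. *)
Definition ej_rank : nat :=
  xget 0%N [set r | exists J : 'I_r -> E, jordan_frame J].

(* The eigenvalues in nonincreasing order; by the spectral theorem exactly one
   vector satisfies the condition, so the default value 0 is irrelevant. *)
Definition eigenvalues x : 'cV[R]_ej_rank :=
  xget 0 [set l : 'cV[R]_ej_rank |
    (forall i j : 'I_ej_rank, (i <= j)%N -> l j 0 <= l i 0) /\
    exists2 J : 'I_ej_rank -> E, jordan_frame J &
      x = \sum_(i < ej_rank) l i 0 *: J i].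

Definition ej_trace x : R := \sum_(i < ej_rank) eigenvalues x i 0.

(* The inner product used for the analysis on [E]; it need not coincide with
   the form [ej_inner] that comes with the structure. *)
Definition trace_inner x y : R := ej_trace (ej_mul E x y).

End EuclideanJordanAlgebra.

Definition dotprod (R : realType) (r : nat) (u v : 'cV[R]_r) : R :=
  \sum_(i < r) u i 0 * v i 0.

Definition symmetric_fun (R : realType) (r : nat) (f : 'cV[R]_r -> R) :=
  forall (P : 'M[R]_r) (u : 'cV[R]_r), is_perm_mx P -> f (P *m u) = f u.

Definition spectral_fun (R : realType) (E : euclideanJordanAlgebra R)
    (f : 'cV[R]_(ej_rank E) -> R) (x : E) : R := f (eigenvalues x).

(* The space [V] is equipped with an inner product [ip], which carries the norm
   and the topology; [ip] is either [dotprod] or [trace_inner]. *)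
Section Subdifferential.
Variables (R : realType) (V : lmodType R) (ip : V -> V -> R).
Implicit Types (g : V -> R) (u v d : V) (C : set V).

Definition ipnorm v : R := Num.sqrt (ip v v).

Definition ipnbhs u : set_system V :=
  filter_from [set e : R | 0 < e] (fun e => [set v | ipnorm (v - u) < e]).

Definition lsc g := forall u (a : R), a < g u -> ipnbhs u [set v | a < g v].

(* The formula of [limf_einfE]; [limf_einf] itself needs a [filteredType]. *)
Definition liminf_along (F : set_system V) (h : V -> \bar R) : \bar R :=
  ereal_sup [set ereal_inf (h @` A) | A in F].

Definition regular_subdifferential g u : set V :=
  [set d | (0 <= liminf_along (within [set v | v != 0%R] (ipnbhs 0%R))
     (fun v => ((g (u + v) - g u - ip d v) / ipnorm v)%:E))%E].

Definition ipcvg (u_ : nat -> V) u := ipnorm (u_ k - u) @[k --> \oo] --> (0 : R).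

Definition subdifferential g u : set V :=
  [set d | exists u_ d_ : nat -> V,
    [/\ ipcvg u_ u, ipcvg d_ d, g (u_ k) @[k --> \oo] --> g u &
        forall k, regular_subdifferential g (u_ k) (d_ k)]].

Definition dom_subdifferential g : set V := [set u | subdifferential g u !=set0].

Definition ipdist u C : \bar R := ereal_inf [set (ipnorm (v - u))%:E | v in C].

End Subdifferential.

(* The conditions on [psi : [0, nu) -> R_+]; the values of [psi] outside
   [0, nu) play no role. *)
Definition desingularizing (R : realType) (psi : R -> R) (nu : \bar R) :=
  let I : set R := [set t | 0 <= t /\ (t%:E < nu)%E] in
  let I0 : set R := [set t | 0 < t /\ (t%:E < nu)%E] in
  [/\ {within I, continuous psi},
      forall (s t a : R), I s -> I t -> 0 <= a <= 1 ->
        a * psi s + (1 - a) * psi t <= psi (a * s + (1 - a) * t),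
      psi 0 = 0 /\ (forall t, I t -> 0 <= psi t),
      (forall t, I0 t -> derivable psi t 1) /\ {within I0, continuous derive1 psi} &
      forall t, I0 t -> 0 < derive1 psi t].

Section KL.
Variables (R : realType) (V : lmodType R) (ip : V -> V -> R).

Definition KL_with (g : V -> R) (u : V) (psi : R -> R) (nu : \bar R) :=
  [/\ lsc ip g, dom_subdifferential ip g u, (0 < nu)%E, desingularizing psi nu &
      exists2 U : set V, ipnbhs ip u U &
        forall v, U v -> ((g u)%:E < (g v)%:E < (g u)%:E + nu)%E ->
          (1 <= (derive1 psi (g v - g u))%:E * ipdist ip 0%R (subdifferential ip g v))%E].

Definition KL_property (g : V -> R) (u : V) :=
  exists (psi : R -> R) (nu : \bar R), KL_with g u psi nu.

Definition KL_exponent (g : V -> R) (u : V) (alpha : R) :=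
  exists (c : R) (nu : \bar R),
    0 < c /\ KL_with g u (fun t => c * t `^ (1 - alpha)) nu.

End KL.

(* Main.v *)
(** Everything rests on the inequality [tr (x y) <= <lambda x, lambda y>]. It
    makes [lambda] 1-Lipschitz, and it shows that [d] in the regular
    subdifferential of [f] at [u] gives [\sum_i d_i c_i] in that of [F] at
    [\sum_i u_i c_i], for every Jordan frame [c]: after reordering the frame so
    that [u + t d] is nonincreasing for small [t > 0], the inequality for
    [u + t d] reads [<d, lambda (x + z) - u> >= <\sum_i d_i c_i, z> - |z|^2 / 2t].
    Conversely, if [x = \sum_i lambda_i(x) c_i] and [D] is a regular subgradient of
    [F] at [x], the vector of the [<D, c_i>] is one of [f] at [lambda x], of norm
    at most [|D|]; that [D] need not be diagonal in the frame is harmless, since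
    only the distances from 0 to the subdifferentials matter. Passing to limits,
    these distances agree at [x] and [lambda x], so the Kurdyka-Lojasiewicz
    inequality transfers with the same [psi] and [nu].

    The trace is obtained as [x |-> <x, w>] with [w = \sum_i c_i / <c_i, c_i>] for
    an arbitrary associative inner product: nonorthogonal primitive idempotents
    have the same norm, so this functional is 1 on every primitive idempotent. *)

From HB Require Import structures.
Require Import Defs.
From mathcomp Require Import all_boot all_order all_algebra fingroup perm.
From mathcomp Require Import all_classical all_reals all_analysis.
From mathcomp Require Import ring lra complex.

Set Implicit Arguments.
Unset Strict Implicit.
Unset Printing Implicit Defensive.

Import Order.TTheory GRing.Theory Num.Theory.
Import numFieldNormedType.Exports.

Local Open Scope classical_set_scope.
Local Open Scope ring_scope.

(** * Jordan identities *)

Section JordanIdentities.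
Variables (R : realType) (E : euclideanJordanAlgebra R).
Implicit Types x y z c d : E.
Local Notation "x ** y" := (ej_mul E x y) (at level 40, left associativity).
Local Notation "''[' u , v ]" := (ej_inner E u v).
Local Notation e := (ej_one E).

Lemma jmulDl x y z : (x + y) ** z = x ** z + y ** z.
Proof. exact: linearDl. Qed.
Lemma jmulDr x y z : x ** (y + z) = x ** y + x ** z.
Proof. exact: linearD. Qed.
Lemma jmulNl x y : (- x) ** y = - (x ** y).
Proof. exact: linearNl. Qed.
Lemma jmulNr x y : x ** (- y) = - (x ** y).
Proof. exact: linearN. Qed.
Lemma jmulZl (a : R) x y : (a *: x) ** y = a *: (x ** y).
Proof. exact: linearZl_LR. Qed.
Lemma jmulZr (a : R) x y : x ** (a *: y) = a *: (x ** y).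
Proof. exact: linearZ. Qed.
Lemma jmul0r x : x ** 0 = 0.
Proof. exact: linear0. Qed.
Lemma jmul1r x : x ** e = x.
Proof. by rewrite ej_mulC ej_mul1. Qed.
Lemma jmul_sumr (I : Type) (s : seq I) (P : pred I) (F : I -> E) x :
  x ** (\sum_(i <- s | P i) F i) = \sum_(i <- s | P i) x ** F i.
Proof. exact: linear_sum. Qed.
Lemma jmul_suml (I : Type) (s : seq I) (P : pred I) (F : I -> E) x :
  (\sum_(i <- s | P i) F i) ** x = \sum_(i <- s | P i) F i ** x.
Proof. by rewrite ej_mulC jmul_sumr; apply: eq_bigr => i _; rewrite ej_mulC. Qed.

Lemma innerC x y : '[x, y] = '[y, x].
Proof. by rewrite hermC /= expr0 mul1r. Qed.
Lemma innerDl x y z : '[x + y, z] = '[x, z] + '[y, z].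
Proof. exact: linearDl. Qed.
Lemma innerDr x y z : '[x, y + z] = '[x, y] + '[x, z].
Proof. exact: linearD. Qed.
Lemma innerNl x y : '[- x, y] = - '[x, y].
Proof. exact: linearNl. Qed.
Lemma innerNr x y : '[x, - y] = - '[x, y].
Proof. exact: linearN. Qed.
Lemma innerZl (a : R) x y : '[a *: x, y] = a * '[x, y].
Proof. exact: linearZl_LR. Qed.
Lemma innerZr (a : R) x y : '[x, a *: y] = a * '[x, y].
Proof. exact: linearZ. Qed.
Lemma inner0l x : '[0, x] = 0.
Proof. exact: linear0l. Qed.
Lemma inner_sumr (I : Type) (s : seq I) (P : pred I) (F : I -> E) x :
  '[x, \sum_(i <- s | P i) F i] = \sum_(i <- s | P i) '[x, F i].
Proof. exact: linear_sum. Qed.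
Lemma inner_suml (I : Type) (s : seq I) (P : pred I) (F : I -> E) x :
  '[\sum_(i <- s | P i) F i, x] = \sum_(i <- s | P i) '[F i, x].
Proof. by rewrite innerC inner_sumr; apply: eq_bigr => i _; rewrite innerC. Qed.

Lemma inner_gt0 x : x != 0 -> 0 < '[x, x].
Proof. exact: neq0_dnorm_gt0. Qed.
Lemma inner_ge0 x : 0 <= '[x, x].
Proof. by have [->|/inner_gt0/ltW//] := eqVneq x 0; rewrite inner0l. Qed.
Lemma inner_eq0 x : '[x, x] = 0 -> x = 0.
Proof. by have [//|/inner_gt0/lt0r_neq0/eqP] := eqVneq x 0. Qed.

Lemma inner_ext x y : (forall z, '[x, z] = '[y, z]) -> x = y.
Proof.
move=> xy; apply/eqP; rewrite -subr_eq0; apply/eqP/inner_eq0.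
by rewrite innerDl innerNl xy subrr.
Qed.

Lemma inner_mul x y z : '[x ** y, z] = '[y, x ** z].
Proof. by rewrite ej_mulC ej_inner_assoc. Qed.

Let jE := (jmulDl, jmulDr, jmulNl, jmulNr, jmulZl, jmulZr).
Let iE := (innerDl, innerDr, innerNl, innerNr, innerZl, innerZr).

(** The Jordan identity is cubic in its first argument; this is the part linear in [z] of the
    identity at [x + z]. The difference with [x - z] keeps the odd part, from which the identity at
    [z] removes the cubic term. *)
Lemma jordan_linearized x y z :
  z ** ((x ** x) ** y) + 2 *: (x ** ((x ** z) ** y)) =
  (x ** x) ** (z ** y) + 2 *: ((x ** z) ** (x ** y)).
Proof.
have H1 := ej_jordan (x + z) y; have H2 := ej_jordan (x - z) y.
have H3 := ej_jordan z y.
(* Pairing with an arbitrary [w] turns vector identities into scalar ones, within reach of [lra]. *)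
apply: inner_ext => w.
move: (congr1 (fun u => '[u, w]) H1) (congr1 (fun u => '[u, w]) H2)
  (congr1 (fun u => '[u, w]) H3).
rewrite !jE (ej_mulC z x) !iE => h1 h2 h3.
lra.
Qed.

(** Peirce theory: multiplication by [c] is annihilated by [t (2 t - 1) (t - 1)]. This is the
    linearized identity with two arguments equal to [c]. *)
Lemma idempotent_cubic c x : idempotent_elt c ->
  2 *: (c ** (c ** (c ** x))) = 3 *: (c ** (c ** x)) - c ** x.
Proof.
move=> cc; have := jordan_linearized c c x; rewrite !cc => H.
move: H; rewrite (ej_mulC x c) (ej_mulC (c ** x) c) => H.
apply: inner_ext => w; move: (congr1 (fun u => '[u, w]) H).
rewrite !iE; lra.
Qed.

(* On the eigenvalues 0, 1/2, 1 of [c ** _], the polynomial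
   [(t (2 t - 1)) ^ 2 + 8 (t (1 - t)) ^ 2] takes the value [t]. *)
Lemma idempotent_inner_sumsq c x : idempotent_elt c ->
  let y := 2 *: (c ** (c ** x)) - c ** x in let z := c ** x - c ** (c ** x) in
  '[c ** x, x] = '[y, y] + 8 * '[z, z].
Proof.
move=> cc y z.
(* Multiplication by [c] is self-adjoint, so only the moments [<c^k x, x>] with [k <= 4] occur; the
   cubic relation at [x] and at [c ** x] reduces those with [k = 3, 4]. *)
have H1 := congr1 (fun u => '[u, x]) (idempotent_cubic x cc).
have H2 := congr1 (fun u => '[u, x]) (idempotent_cubic (c ** x) cc).
move: H1 H2; rewrite /y /z !iE !inner_mul.
move=> H1 H2; lra.
Qed.

Lemma idempotent_inner_ge0 c x : idempotent_elt c -> 0 <= '[c ** x, x].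
Proof.
move=> cc; rewrite (idempotent_inner_sumsq x cc).
by rewrite addr_ge0 ?inner_ge0// mulr_ge0 ?inner_ge0.
Qed.

Lemma idempotent_inner_eq0 c x : idempotent_elt c ->
  '[c ** x, x] = 0 -> c ** x = 0.
Proof.
move=> cc; rewrite (idempotent_inner_sumsq x cc).
set y := _ - c ** x; set z := c ** x - _ => yz.
have [y0 z0] := (inner_ge0 y, inner_ge0 z).
have /inner_eq0 yE : '[y, y] = 0 by lra.
have /inner_eq0 zE : '[z, z] = 0 by lra.
(* [c ** x = y + 2 z], and both [y] and [z] vanish. *)
apply: inner_ext => w.
move: (congr1 (fun u => '[u, w]) yE) (congr1 (fun u => '[u, w]) zE).
rewrite /y /z !iE inner0l; lra.
Qed.

Lemma idempotent_pair_inner_ge0 c d :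
  idempotent_elt c -> idempotent_elt d -> 0 <= '[c, d].
Proof.
by move=> cc dd; rewrite -[X in '[_, X]]dd -ej_inner_assoc idempotent_inner_ge0.
Qed.

Lemma idempotent_pair_inner_eq0 c d : idempotent_elt c -> idempotent_elt d ->
  '[c, d] = 0 -> c ** d = 0.
Proof.
move=> cc dd cd; apply: idempotent_inner_eq0 => //.
by rewrite ej_inner_assoc dd.
Qed.

(** * Power associativity *)

Fixpoint jpow x n := if n is m.+1 then x ** jpow x m else e.

Lemma jpow_mul2 x n : (x ** x) ** jpow x n = jpow x n.+2.
Proof.
elim: n => [|n IHn] /=; first by rewrite !jmul1r.
by rewrite -ej_jordan IHn.
Qed.

(** Induction on two consecutive exponents: the linearized identity ([K] below) writes
    multiplication by [x^(n+2)] through the multiplications by [x], [x^2], [x^n] and [x^(n+1)],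
    which all commute with that by [x]. *)
Lemma jpow_commute x n y : x ** (jpow x n ** y) = jpow x n ** (x ** y).
Proof.
have [/(_ y)] : (forall y, x ** (jpow x n ** y) = jpow x n ** (x ** y)) /\
   (forall y, x ** (jpow x n.+1 ** y) = jpow x n.+1 ** (x ** y)); last by [].
elim: n {y} => [|n [IH1 IH2]].
  by split=> y /=; rewrite ?jmul1r// !ej_mul1.
split=> // y.
have K z : jpow x n.+2 ** z = (x ** x) ** (jpow x n ** z)
    + 2 *: (jpow x n.+1 ** (x ** z)) - 2 *: (x ** (jpow x n ** (x ** z))).
  have := jordan_linearized x (jpow x n) z; rewrite jpow_mul2.
  rewrite (ej_mulC _ (jpow x n.+2)) (ej_mulC z (jpow x n)).
  rewrite (ej_mulC (x ** z) (jpow x n)) (ej_mulC (x ** z)).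
  by move=> <-; rewrite addrK.
by rewrite !K !jE ej_jordan IH2 !IH1.
Qed.

Lemma jpowD x m n : jpow x m ** jpow x n = jpow x (m + n).
Proof.
elim: n => [|n IHn] /=; first by rewrite jmul1r addn0.
by rewrite -jpow_commute IHn addnS.
Qed.

End JordanIdentities.

(** * Spectral theorem *)

Section SpectralTheorem.
Variables (R : realType) (E : euclideanJordanAlgebra R).
Implicit Types (x y c d : E) (p q : {poly R}).
Local Notation "x ** y" := (ej_mul E x y) (at level 40, left associativity).
Local Notation "''[' u , v ]" := (ej_inner E u v).
Local Notation e := (ej_one E).

Definition jeval x p : E := \sum_(i < size p) p`_i *: jpow x i.

Lemma jeval_widen x p n : (size p <= n)%N ->
  jeval x p = \sum_(i < n) p`_i *: jpow x i.
Proof.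
move=> pn; rewrite /jeval (big_ord_widen _ (fun i => p`_i *: jpow x i) pn).
rewrite big_mkcond; apply: eq_bigr => i _; case: ltnP => // pi.
by rewrite nth_default// scale0r.
Qed.

Fact jeval_linear x : linear (jeval x).
Proof.
move=> a p q; set n := maxn (size (a *: p + q)) (maxn (size p) (size q)).
rewrite !(@jeval_widen x _ n) ?leq_maxl// /n ?leq_max ?leqnn ?orbT//.
rewrite scaler_sumr -big_split /=; apply: eq_bigr => i _.
by rewrite coefD coefZ scalerDl scalerA.
Qed.

HB.instance Definition _ x :=
  GRing.isLinear.Build R {poly R} E _ (jeval x) (jeval_linear x).

Lemma jeval_sum x (I : Type) (s : seq I) (P : pred I) (F : I -> {poly R}) :
  jeval x (\sum_(i <- s | P i) F i) = \sum_(i <- s | P i) jeval x (F i).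
Proof. exact: linear_sum. Qed.

Lemma jevalXn x n : jeval x 'X^n = jpow x n.
Proof.
rewrite (@jeval_widen x _ n.+1) ?size_polyXn// big_ord_recr/= big1 ?add0r.
  by rewrite coefXn eqxx scale1r.
by move=> i _; rewrite coefXn ltn_eqF// scale0r.
Qed.

Lemma jeval1 x : jeval x 1 = e.
Proof. by rewrite -(expr0 'X) jevalXn. Qed.

Lemma jevalX x : jeval x 'X = x.
Proof. by rewrite -(expr1 'X) jevalXn /= jmul1r. Qed.

(** The subalgebra generated by [x] is an image of [R[X]], hence associative; the spectral theory of
    one element reduces to factoring polynomials. *)
Lemma jevalM x p q : jeval x (p * q) = jeval x p ** jeval x q.
Proof.
rewrite -{1}(coefK p) -{1}(coefK q) !poly_def mulr_suml jeval_sum jmul_suml.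
apply: eq_bigr => i _; rewrite mulr_sumr jeval_sum jmul_sumr.
apply: eq_bigr => j _; rewrite jmulZl jmulZr -scalerAl -scalerAr.
by rewrite linearZ /= linearZ /= -exprD jevalXn jpowD.
Qed.

(** The first [\dim E + 1] powers of [x] are linearly dependent. *)
Lemma jeval_annihilator x : exists2 p, p != 0 & jeval x p = 0.
Proof.
pose n := \dim {:E}; pose X := [tuple jpow x i | i < n.+1].
have : ~~ free X.
  rewrite /free size_tuple neq_ltn ltnS.
  by rewrite (dimvS (subvf _)).
move/freeP => /existsNP[k /not_implyP[kX /existsNP[i /eqP ki]]].
exists (\poly_(j < n.+1) k (inord j)).
  apply/negP => /eqP/(congr1 (fun p : {poly R} => p`_i)).
  by rewrite coef_poly ltn_ord coef0 inord_val => /eqP; apply/negP.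
rewrite (@jeval_widen x _ n.+1) ?size_poly// -[RHS]kX; apply: eq_bigr => j _.
by rewrite coef_poly ltn_ord inord_val (nth_map ord0) ?size_enum_ord// nth_ord_enum.
Qed.

Lemma inner_square_one x : '[x ** x, e] = '[x, x].
Proof. by rewrite ej_inner_assoc jmul1r. Qed.

Definition minimal_annihilator x p :=
  [/\ p != 0, jeval x p = 0 &
      forall q, q != 0 -> jeval x q = 0 -> (size p <= size q)%N].

Lemma minimal_annihilator_exists x : exists p, minimal_annihilator x p.
Proof.
pose P n := `[< exists p, [/\ p != 0, jeval x p = 0 & size p = n] >].
have [p0 p0N0 p0x] := jeval_annihilator x.
have exP : exists n, P n by exists (size p0); apply/asboolP; exists p0.
have [_ /asboolP[p [pN0 px <-]] minp] := ex_minnP exP.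
exists p; split=> // q qN0 qx; apply: minp; apply/asboolP; by exists q.
Qed.

(* Covers at once a double real root ([b = 0]) and a nonreal root [a + ib]: in
   both cases positive definiteness gives [jeval x ((X - a) q) = 0]. *)
Lemma minimal_annihilator_ndvd x p (a b : R) : minimal_annihilator x p ->
  ~~ (('X - a%:P) ^+ 2 + (b ^+ 2)%:P %| p).
Proof.
move=> [pN0 px minp]; apply/negP => /dvdpP[q pE].
set r := ('X - a%:P) ^+ 2 + _ in pE.
have rsz : size r = 3%N.
  rewrite /r size_polyDl size_exp_XsubC//.
  by rewrite (leq_ltn_trans (size_polyC_leq1 _)).
have qN0 : q != 0 by apply: contraNneq pN0 => q0; rewrite pE q0 mul0r.
have rN0 : r != 0 by rewrite -size_poly_eq0 rsz.
pose u := jeval x (('X - a%:P) * q).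
(* The left side is the pairing with [e] of the value at [x] of [((X - a) q)^2 + b^2 q^2 = q p]. *)
have uu : '[u, u] + b ^+ 2 * '[jeval x q, jeval x q] = 0.
  rewrite -inner_square_one -[X in _ + _ * X]inner_square_one -innerZl -innerDl.
  rewrite -!jevalM -linearZ -linearD /= (_ : _ + _ = q * p).
    by rewrite jevalM px jmul0r inner0l.
  by rewrite pE /r -mul_polyC; ring.
have /inner_eq0 u0 : '[u, u] = 0.
  apply/eqP; rewrite eq_le inner_ge0 andbT -uu lerDl.
  by rewrite mulr_ge0 ?inner_ge0 ?sqr_ge0.
have XN0 : 'X - a%:P != 0 by rewrite polyXsubC_eq0.
(* [(X - a) q] annihilates [x] and has degree one less than [p]. *)
have := minp _ (mulf_neq0 XN0 qN0) u0.
rewrite pE !size_mul// size_XsubC rsz.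
have : (0 < size q)%N by rewrite size_poly_gt0.
by case: (size q) => // n _; rewrite addnC /= ltnn.
Qed.

(** A minimal annihilator splits over [R[i]]. A nonreal root, taken with its conjugate, or a
    repeated real root would give a divisor [(X - a)^2 + b^2], so the roots are real and simple. *)
Lemma split_annihilator x : exists2 s : seq R, uniq s &
  jeval x (\prod_(a <- s) ('X - a%:P)) = 0.
Proof.
have [p pmin] := minimal_annihilator_exists x; have [pN0 px _] := pmin.
pose f : {rmorphism R -> R[i]} := real_complex R.
have [s sE] := closed_field_poly_normal (map_poly f p).
have fX a : map_poly f ('X - a%:P) = 'X - (f a)%:P.
  by rewrite rmorphB /= map_polyX map_polyC.
have ndvd (a b : R) :
    ~~ (('X - (f a)%:P) ^+ 2 + (f b ^+ 2)%:P %| map_poly f p).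
  have := minimal_annihilator_ndvd a b pmin; apply: contraNN.
  rewrite -fX -rmorphXn -rmorphXn -[X in _ + X](map_polyC f).
  by rewrite -rmorphD /= dvdp_map.
have real_s z : z \in s -> z = f (complex.Re z).
  move=> zs; apply/eqP; apply: contraT => zN.
  have rz : root (map_poly f p) z.
    by rewrite sE rootZ ?root_prod_XsubC// lead_coef_eq0 map_poly_eq0.
  have rcz : root (map_poly f p) (conjc z).
    rewrite -complex_root_conj -map_poly_comp (@eq_map_poly _ _ _ f)// => a /=.
    by rewrite /= oppr0.
  have := ndvd (complex.Re z) (complex.Im z).
  pose i := ('i%C : R[i])%:P.
  have ii : i * i = -1 by rewrite -polyCM -expr2 sqr_i polyCN.
  rewrite (_ : _ + _ = ('X - z%:P) * ('X - (conjc z)%:P)); last first.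
    have -> : z%:P = (f (complex.Re z))%:P + i * (f (complex.Im z))%:P.
      by rewrite -polyCM -polyCD [in LHS](complexE z).
    have -> : (conjc z)%:P = (f (complex.Re z))%:P - i * (f (complex.Im z))%:P.
      by rewrite -polyCM -polyCB; congr polyC; case: (z) => a b; simpc.
    by rewrite rmorphXn /=; ring: ii.
  rewrite Gauss_dvdp ?dvdp_XsubCl ?rz ?rcz// coprimep_XsubC root_XsubC.
  apply: contraNN zN; case: (z) => a b; rewrite !eq_complex /= eqxx /=.
  by rewrite eqr_oppLR => /eqP bN; apply/eqP; lra.
have uniq_s : uniq s.
  apply: count_mem_uniq => z; have [zs|/count_memPn//] := boolP (z \in s).
  have /seq.permP -> := perm_to_rem zs; rewrite /= eqxx.
  have [zs'|/count_memPn -> //] := boolP (z \in rem z s).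
  have := ndvd (complex.Re z) 0; rewrite -(real_s _ zs) rmorph0 expr0n addr0.
  rewrite sE (perm_big _ (perm_to_rem zs)) big_cons.
  rewrite (perm_big _ (perm_to_rem zs')) big_cons /= mulrA -expr2 scalerAr.
  by rewrite dvdp_mulr.
have pE : p = lead_coef p *: \prod_(a <- map (@complex.Re R) s) ('X - a%:P).
  apply: (map_poly_inj f); rewrite sE map_polyZ /= lead_coef_map; congr (_ *: _).
  rewrite rmorph_prod big_map; apply: eq_big_seq => z zs.
  by rewrite {1}(real_s _ zs) [RHS]fX.
exists (map (@complex.Re R) s).
  rewrite map_inj_in_uniq// => z w zs ws zw.
  by rewrite (real_s _ zs) (real_s _ ws) zw.
move: px; rewrite pE linearZ /= => /eqP; rewrite scaler_eq0 lead_coef_eq0.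
by rewrite (negPf pN0) => /eqP.
Qed.

(** Induction on the roots, applied to [(X - a) q]. On a component for the root [b], [X - a] acts as
    [b - a], so dividing by this number gives the components of [q] for [b <> a]; what remains of
    [q] is killed by [X - a]. *)
Lemma eigenspace_decomposition x (s : seq R) q : uniq s ->
  jeval x (\prod_(a <- s) ('X - a%:P) * q) = 0 ->
  exists2 h : R -> {poly R}, jeval x q = \sum_(a <- s) jeval x (h a) &
    forall a, a \in s -> jeval x (('X - a%:P) * h a) = 0.
Proof.
elim: s q => [|a s IHs] q /=.
  by rewrite !big_nil mul1r => _ q0; exists (fun=> 0); rewrite ?big_nil.
move=> /andP[aNs us]; rewrite big_cons mulrAC mulrC => /(IHs _ us)[h hE hs].
pose k b := (b - a)^-1 *: h b.
exists (fun b => if b == a then q - \sum_(b <- s) k b else k b).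
  rewrite big_cons eqxx linearB /= jeval_sum /=.
  rewrite [X in _ = _ - _ + X](_ : _ = \sum_(b <- s) jeval x (k b)) ?subrK//.
  by apply: eq_big_seq => b bs; case: eqP => // ba; rewrite -ba bs in aNs.
move=> b; rewrite inE; case: eqP => [-> _|_ /= bs]; last first.
  by rewrite /k -scalerAr linearZ /= hs// scaler0.
rewrite mulrBr linearB /= hE mulr_sumr jeval_sum -sumrB big1_seq// => b' bs.
apply/eqP; rewrite subr_eq0; apply/eqP.
have ba : b' - a != 0.
  by rewrite subr_eq0; apply: contraNneq aNs => <-.
rewrite /k -scalerAr linearZ /=.
rewrite (_ : 'X - a%:P = ('X - b'%:P) + (b' - a)%:P); last by rewrite polyCB; ring.
by rewrite mulrDl linearD /= hs// add0r mul_polyC linearZ /= scalerA mulVf// scale1r.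
Qed.

Definition orthogonal_idempotents n (J : 'I_n -> E) :=
  [/\ forall i, idempotent_elt (J i), forall i, J i != 0,
      forall i j, i != j -> J i ** J j = 0 & \sum_(i < n) J i = e].

(** The idempotents are the components of [e] in the eigenspaces of [x]. Moving [x] across
    [g a ** g b] shows that this product is 0 for [a <> b]; multiplying [g a] by [e], the sum of all
    components, then gives idempotence. *)
Lemma orthogonal_idempotents_exists x : exists n (J : 'I_n -> E) (l : 'I_n -> R),
  orthogonal_idempotents J /\ x = \sum_(i < n) l i *: J i.
Proof.
have [s us sx] := split_annihilator x.
have [|h hE hs] := @eigenspace_decomposition x s 1 us; first by rewrite mulr1.
rewrite jeval1 in hE; pose g a := jeval x (h a).
have xg a : a \in s -> x ** g a = a *: g a.
  move=> /hs; rewrite mulrBl mul_polyC linearB /= linearZ /= jevalM jevalX.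
  by move/eqP; rewrite subr_eq0 => /eqP.
have gg a b : a \in s -> b \in s -> a != b -> g a ** g b = 0.
  move=> sa sb ab; have : a *: (g a ** g b) = b *: (g a ** g b).
    rewrite -jmulZl -jmulZr -!xg// -[X in X ** g a](jevalX x).
    rewrite -[X in _ = _ ** (X ** g b)](jevalX x) -!jevalM.
    by congr jeval; ring.
  move/eqP; rewrite -subr_eq0 -scalerBl scaler_eq0 subr_eq0 (negPf ab) /=.
  by move/eqP.
have gid a : a \in s -> idempotent_elt (g a).
  move=> sa; rewrite /idempotent_elt -[RHS]jmul1r hE jmul_sumr.
  rewrite (bigD1_seq a)//= big1_seq ?addr0// => b /andP[ba sb].
  by rewrite gg// eq_sym.
(* Vanishing components are dropped, since the members of the family have to be nonzero. *)
pose t := [seq a <- s | g a != 0].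
have ts i : (i < size t)%N -> t`_i \in s /\ g t`_i != 0.
  by move=> it; have := mem_nth 0 it; rewrite mem_filter => /andP[].
have st (F : R -> E) : (forall a, g a = 0 -> F a = 0) ->
    \sum_(a <- s) F a = \sum_(i < size t) F t`_i.
  move=> F0; rewrite (bigID (fun a => g a != 0)) /= [X in _ + X]big1 ?addr0.
    by rewrite -big_filter -/t (big_nth 0) big_mkord.
  by move=> a; rewrite negbK => /eqP/F0.
exists (size t), (fun i => g t`_i), (fun i => t`_i); split; last first.
  rewrite -{1}(jmul1r x) hE jmul_sumr -(st (fun a => a *: g a)) => [|a ->].
    by apply: eq_big_seq => a; exact: xg.
  by rewrite scaler0.
split=> [i|i|i j ij|]; rewrite -?(st g)//; have [si gi] := ts _ (ltn_ord i) => //.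
  exact: gid.
have [sj gj] := ts _ (ltn_ord j); apply: gg => //.
by rewrite nth_uniq// filter_uniq.
Qed.

(** Such idempotents are orthogonal for the inner product, hence independent. The bound makes a
    longest family available. *)
Lemma orthogonal_idempotents_leq n (J : 'I_n -> E) :
  orthogonal_idempotents J -> (n <= \dim {:E})%N.
Proof.
move=> [Jid JN0 JJ _].
have : free [tuple J i | i < n].
  apply/freeP => k kJ i; have /eqP := congr1 (fun u => '[u, J i]) kJ.
  rewrite inner0l inner_suml (bigD1 i)//= big1 => [|j ji].
    rewrite (nth_map i) ?size_enum_ord// nth_ord_enum innerZl addr0 mulf_eq0.
    by rewrite (gt_eqF (inner_gt0 (JN0 i))) orbF => /eqP.
  rewrite (nth_map i) ?size_enum_ord// nth_ord_enum innerZl -[J i]Jid.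
  by rewrite -ej_inner_assoc JJ// inner0l mulr0.
by rewrite /free size_tuple => /eqP <-; rewrite dimvS// subvf.
Qed.

(** Take a longest decomposition of [x] into orthogonal idempotents. A splitting [J i = a + b] would
    give a longer one, with coefficient [l i] on both [a] and [b]. *)
Theorem spectral_theorem x : exists n (J : 'I_n -> E) (l : 'I_n -> R),
  jordan_frame J /\ x = \sum_(i < n) l i *: J i.
Proof.
pose P n := `[< exists (J : 'I_n -> E) (l : 'I_n -> R),
  orthogonal_idempotents J /\ x = \sum_(i < n) l i *: J i >].
have exP : exists n, P n.
  have [n [J [l Jl]]] := orthogonal_idempotents_exists x.
  by exists n; apply/asboolP; exists J, l.
have boundP n : P n -> (n <= \dim {:E})%N.
  by move=> /asboolP[J [l [/orthogonal_idempotents_leq]]].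
have [n /asboolP[J [l [[Jid JN0 JJ Je] xE]]] maxn] := ex_maxnP exP boundP.
exists n, J, l; split=> //; split=> // i; split=> //.
move=> [a [b [[ida aN0] [idb bN0] ab Jab]]].
suff /maxn : P n.+1 by rewrite ltnn.
(* The pairings of [J j] with [a] and with [b] are nonnegative and add up to [<J j, J i> = 0]. *)
have Jperp j : j != i -> J j ** a = 0 /\ J j ** b = 0.
  move=> ji; have : '[J j, J i] = 0.
    by rewrite -[X in '[_, X]]Jid -ej_inner_assoc JJ// inner0l.
  rewrite Jab innerDr => ab0.
  have a0 := idempotent_pair_inner_ge0 (Jid j) ida.
  have b0 := idempotent_pair_inner_ge0 (Jid j) idb.
  by split; apply: idempotent_pair_inner_eq0 => //; lra.
(* [a] takes the place of [J i], and [b] is appended at the last index. *)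
pose J' k := if unlift ord_max k is Some j then if j == i then a else J j else b.
pose l' k := if unlift ord_max k is Some j then l j else l i.
pose w (j : 'I_n) := widen_ord (leqnSn n) j.
have J'w j : J' (w j) = if j == i then a else J j.
  rewrite /J' (_ : w j = lift ord_max j) ?liftK//.
  by apply: val_inj; rewrite /= /bump leqNgt ltn_ord.
have l'w j : l' (w j) = l j.
  rewrite /l' (_ : w j = lift ord_max j) ?liftK//.
  by apply: val_inj; rewrite /= /bump leqNgt ltn_ord.
have sumJ' (m : 'I_n -> R) :
    \sum_(j < n) m j *: J' (w j) + m i *: b = \sum_(j < n) m j *: J j.
  rewrite (bigD1 i)//= [RHS](bigD1 i)//= J'w eqxx addrAC -scalerDr -Jab.
  by congr (_ + _); apply: eq_bigr => j ji; rewrite J'w (negPf ji).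
apply/asboolP; exists J', l'; split; last first.
  rewrite big_ord_recr /= {2}/l' {2}/J' unlift_none xE -sumJ'; congr (_ + _).
  by apply: eq_bigr => j _; rewrite l'w.
split=> [k|k|k1 k2|]; last first.
- rewrite big_ord_recr /= {2}/J' unlift_none -Je.
  have := sumJ' (fun=> 1); rewrite scale1r.
  rewrite (eq_bigr _ (fun j _ => scale1r (J' (w j)))).
  by rewrite [RHS](eq_bigr _ (fun j _ => scale1r (J j))).
- rewrite /J'; case: unliftP => [j1|] ->; case: unliftP => [j2|] ->.
  + rewrite (inj_eq (@lift_inj _ _)) => j12.
    have [j1i|j1i] := eqVneq j1 i; have [j2i|j2i] := eqVneq j2 i.
    * by rewrite j1i j2i eqxx in j12.
    * by rewrite ej_mulC (Jperp _ j2i).1.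
    * by rewrite (Jperp _ j1i).1.
    * exact: JJ.
  + by move=> _; case: eqVneq => [//|/Jperp[]].
  + by move=> _; rewrite ej_mulC; case: eqVneq => [//|/Jperp[]].
  + by rewrite eqxx.
- by rewrite /J'; case: unliftP => [j|] _ //; case: (j == i).
- by rewrite /J'; case: unliftP => [j|] _ //; case: (j == i).
Qed.

End SpectralTheorem.

(** * Frames, trace and eigenvalues *)

Section Rearrangement.
Variable R : realType.

Definition nonincreasing n (u : 'cV[R]_n) :=
  forall i j : 'I_n, (i <= j)%N -> u j 0 <= u i 0.

(** General in [le], as it sorts real coordinates and also pairs in lexicographic order. *)
Lemma sort_perm (T : eqType) (le : rel T) n (u : 'I_n -> T) :
  total le -> transitive le ->
  exists s : 'S_n, forall i j : 'I_n, (i <= j)%N -> le (u (s i)) (u (s j)).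
Proof.
move=> tot tr; pose t := [tuple u i | i < n].
have /tuple_permP[s sE] : perm_eq (sort le t) t by rewrite perm_sort.
exists s => i j ij; have := sort_sorted tot t.
have rle : reflexive le by move=> z; have := tot z z; rewrite orbb.
move/(sorted_leq_nth tr rle (u i)) => /(_ i j); rewrite sE !inE size_tuple !ltn_ord.
by move=> /(_ isT isT ij); rewrite -!tnth_nth !tnth_mktuple.
Qed.

(* The dual potentials of the transport problem with cost [a i * b j]: [p] is a
   Riemann sum for the integral of [b da]. *)
Lemma rearrangement_potential n (a b : 'cV[R]_n) :
  nonincreasing a -> nonincreasing b ->
  exists p q : 'I_n -> R, (forall i j, a i 0 * b j 0 <= p i + q j) /\
                          forall i, p i + q i = a i 0 * b i 0.
Proof.
case: n a b => [|n] a b da db.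
  by exists (fun=> 0), (fun=> 0); split=> -[].
(* Both vectors are extended to all naturals as constants beyond the last index. *)
pose A k : R := a (inord (minn k n)) 0; pose B k : R := b (inord (minn k n)) 0.
have AE (i : 'I_n.+1) : A i = a i 0.
  by rewrite /A (minn_idPl _) ?inord_val// -ltnS.
have BE (i : 'I_n.+1) : B i = b i 0.
  by rewrite /B (minn_idPl _) ?inord_val// -ltnS.
have mono k l : (k <= l)%N -> ((inord (minn k n) : 'I_n.+1) <= (inord (minn l n) : 'I_n.+1))%N.
  move=> kl; rewrite !inordK ?ltnS ?geq_minr//.
  by rewrite leq_min geq_minr andbT (leq_trans (geq_minl _ _)).
have dA k l : (k <= l)%N -> A l <= A k by move=> /mono/da.
have dB k l : (k <= l)%N -> B l <= B k by move=> /mono/db.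
pose P k := \sum_(0 <= m < k) (A m.+1 - A m) * B m.
(* Between [i] and [i + d] the weights lie between [B (i + d)] and [B i], which bounds the increment
   of [P] on both sides. *)
have PP i d : (A i - A (i + d)%N) * B (i + d)%N <= P i - P (i + d)%N /\
              (A (i + d)%N - A i) * B i <= P (i + d)%N - P i.
  elim: d => [|d [IH1 IH2]]; first by rewrite addn0 !subrr !mul0r.
  rewrite addnS; have -> : P (i + d).+1 = P (i + d)%N +
      (A (i + d).+1 - A (i + d)%N) * B (i + d)%N by rewrite /P big_nat_recr.
  have A1 := dA _ _ (leqnSn (i + d)%N); have B1 := dB _ _ (leqnSn (i + d)%N).
  have A2 := dA _ _ (leq_addr d i); have B2 := dB _ _ (leq_addr d i).
  by split; nra.
exists (fun i => P i), (fun j => A j * B j - P j); split=> [i j|i]; last first.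
  by rewrite addrC subrK AE BE.
rewrite -AE -BE; have [ij|/ltnW ji] := leqP i j.
  by have [H _] := PP i (j - i)%N; move: H; rewrite subnKC//; lra.
by have [_ H] := PP j (i - j)%N; move: H; rewrite subnKC//; lra.
Qed.

(** Weak duality: bound the cost by [p i + q j], sum using the marginals, and use equality on the
    diagonal. *)
Lemma doubly_stochastic_le n (a b : 'cV[R]_n) (S : 'I_n -> 'I_n -> R) :
  nonincreasing a -> nonincreasing b -> (forall i j, 0 <= S i j) ->
  (forall i, \sum_j S i j = 1) -> (forall j, \sum_i S i j = 1) ->
  \sum_i \sum_j a i 0 * b j 0 * S i j <= dotprod a b.
Proof.
move=> da db S0 Sr Sc; have [p [q [pq pqE]]] := rearrangement_potential da db.
apply: (@le_trans _ _ (\sum_i \sum_j (p i * S i j + q j * S i j))).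
  by apply: ler_sum => i _; apply: ler_sum => j _; rewrite -mulrDl ler_wpM2r.
under eq_bigr do rewrite big_split.
rewrite big_split /= [X in _ + X]exchange_big /=.
under eq_bigr do rewrite -mulr_sumr Sr mulr1.
under [X in _ + X]eq_bigr do rewrite -mulr_sumr Sc mulr1.
by rewrite -big_split /=; under eq_bigr do rewrite pqE.
Qed.

End Rearrangement.

(** * Jordan frames, the trace form and the trace inequality *)

Section Frames.
Variables (R : realType) (E : euclideanJordanAlgebra R).
Implicit Types (x y c d : E).
Local Notation "x ** y" := (ej_mul E x y) (at level 40, left associativity).
Local Notation "''[' u , v ]" := (ej_inner E u v).
Local Notation e := (ej_one E).
Local Notation r := (ej_rank E).

Lemma frame_mul n (J : 'I_n -> E) (a b : 'I_n -> R) : jordan_frame J ->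
  (\sum_i a i *: J i) ** (\sum_i b i *: J i) = \sum_i (a i * b i) *: J i.
Proof.
move=> [Jp JJ _]; rewrite jmul_suml; apply: eq_bigr => i _.
rewrite jmul_sumr (bigD1 i)//= big1 => [|j ji].
  by rewrite jmulZl jmulZr addr0 scalerA; case: (Jp i) => ->.
by rewrite jmulZl jmulZr JJ ?scaler0// eq_sym.
Qed.

(** Otherwise [c = d + (c - d)] is a splitting that primitivity forbids. *)
Lemma primitive_subidempotent c d : primitive_idempotent c ->
  idempotent_elt d -> d != 0 -> c ** d = d -> d = c.
Proof.
move=> [cc _ cN] dd d0 cd; apply/eqP; apply: contraT => dc; case: cN.
exists d, (c - d); split; last by rewrite addrC subrK.
- by [].
- split; last by rewrite subr_eq0 eq_sym.
  rewrite /idempotent_elt jmulDl jmulDr jmulNl jmulNr jmulDr jmulNr.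
  by rewrite cc cd dd (ej_mulC d) cd subrr subr0.
- by rewrite jmulDr jmulNr dd ej_mulC cd subrr.
Qed.

(** Expand [y] in a Jordan frame. Since [(e - c) ** y = 0], the nonnegative numbers
    [l_j^2 <e - c, J j>] sum to 0; so [l_j <> 0] implies [c ** J j = J j], hence [J j = c]. *)
Lemma primitive_eigenline c y : primitive_idempotent c -> c ** y = y ->
  exists a : R, y = a *: c.
Proof.
move=> cp cy; have [cc c0 _] := cp.
have [n [J [l [Jf yE]]]] := spectral_theorem y; have [Jp _ _] := Jf.
have ec : idempotent_elt (e - c).
  rewrite /idempotent_elt jmulDl jmulDr jmulNl jmulNr jmulDr jmulNr.
  by rewrite !ej_mul1 cc jmul1r subrr oppr0 addr0.
have ecy : (e - c) ** y = 0 by rewrite jmulDl jmulNl ej_mul1 cy subrr.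
have Jc i : l i *: J i = if J i == c then l i *: c else 0.
  have [-> //|/eqP Jic] := eqVneq (J i) c.
  have [->|li] := eqVneq (l i) 0; first by rewrite scale0r.
  have [Jii Ji0 _] := Jp i.
  have sum0 : \sum_j l j * l j * '[e - c, J j] = 0.
    transitivity '[e - c, y ** y].
      by rewrite yE frame_mul// inner_sumr; apply: eq_bigr => j _; rewrite innerZr.
    by rewrite -ej_inner_assoc ecy inner0l.
  have ge0 j : 0 <= l j * l j * '[e - c, J j].
    rewrite mulr_ge0// -?expr2 ?sqr_ge0// idempotent_pair_inner_ge0//.
    by case: (Jp j).
  have /(_ i isT)/eqP := psumr_eq0P (fun j _ => ge0 j) sum0.
  rewrite !mulf_eq0 (negPf li) /= => /eqP/(idempotent_pair_inner_eq0 ec Jii).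
  rewrite jmulDl jmulNl ej_mul1 => /eqP; rewrite subr_eq0 eq_sym => /eqP cJ.
  by case: Jic; exact: primitive_subidempotent cJ.
exists (\sum_(i | J i == c) l i); rewrite yE scaler_suml [RHS]big_mkcond.
by apply: eq_bigr => i _; rewrite Jc.
Qed.

(** Write [P c d = a c] and [P d c = b d]. As [<P c d, d>] is symmetric in [c] and [d], [a = b]; and
    [a <c, c> = <c, d> = b <d, d>]. *)
Lemma primitive_inner_eq c d : primitive_idempotent c ->
  primitive_idempotent d -> '[c, d] != 0 -> '[c, c] = '[d, d].
Proof.
(* The quadratic representation of an idempotent [u]: the projection onto the Peirce space where [u]
   acts as 1. *)
pose P u v := 2 *: (u ** (u ** v)) - u ** v.
have eig u v : primitive_idempotent u -> exists a : R, P u v = a *: u.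
  move=> up; apply: primitive_eigenline => //; have [uu _ _] := up.
  rewrite /P jmulDr jmulNr jmulZr (idempotent_cubic _ uu).
  apply: inner_ext => w; rewrite !innerDl !innerNl !innerZl; lra.
have PE u v : primitive_idempotent u -> '[P u v, u] = '[u, v].
  move=> [uu _ _]; rewrite /P innerDl innerNl innerZl !inner_mul !uu.
  rewrite (innerC v); lra.
have PC u v : '[P u v, v] = 2 * '[u ** v, u ** v] - '[u ** v, v].
  by rewrite /P innerDl innerNl innerZl inner_mul.
move=> cp dp cd; have [a aE] := eig c d cp; have [b bE] := eig d c dp.
have : '[P c d, d] = '[P d c, c].
  have [[cc _ _] [dd _ _]] := (cp, dp).
  rewrite !PC (ej_mulC d c); congr (_ - _).
  by rewrite ej_inner_assoc dd (ej_mulC c d) ej_inner_assoc cc innerC.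
rewrite aE bE !innerZl (innerC d c) => /(mulIf cd) ab.
have := PE c d cp; have := PE d c dp; rewrite aE bE !innerZl (innerC d c) -ab.
have [-> |a0] := eqVneq a 0; first by rewrite mul0r => /esym/eqP; rewrite (negPf cd).
by move=> <- /(mulfI a0).
Qed.

Definition frame_weight n (J : 'I_n -> E) : E := \sum_i '[J i, J i]^-1 *: J i.

(** In each nonzero term [<J i, J i> = <d, d>], so the sum is [<d, e> / <d, d>]. *)
Lemma frame_weight_primitive n (J : 'I_n -> E) d :
  jordan_frame J -> primitive_idempotent d -> '[d, frame_weight J] = 1.
Proof.
move=> [Jp _ Je] dp; have [dd d0 _] := dp.
rewrite /frame_weight inner_sumr.
transitivity (\sum_i '[d, d]^-1 * '[d, J i]).
  apply: eq_bigr => i _; rewrite innerZr.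
  have [->|dJ] := eqVneq '[d, J i] 0; first by rewrite !mulr0.
  by rewrite (primitive_inner_eq dp (Jp i) dJ).
rewrite -mulr_sumr -inner_sumr Je -[X in '[X, e]]dd inner_square_one mulVf//.
by rewrite gt_eqF ?inner_gt0.
Qed.

(** Both represent the functional that is 1 on primitive idempotents, which span the algebra. *)
Lemma frame_weight_unique m n (J : 'I_m -> E) (K : 'I_n -> E) :
  jordan_frame J -> jordan_frame K -> frame_weight J = frame_weight K.
Proof.
move=> Jf Kf; apply: inner_ext => z.
have [k [L [l [[Lp _ _] ->]]]] := spectral_theorem z.
rewrite !inner_sumr; apply: eq_bigr => i _.
by rewrite !innerZr 2!(innerC (frame_weight _)) !frame_weight_primitive.
Qed.

(** The length is the trace of [e]. *)
Lemma frame_length_unique m n (J : 'I_m -> E) (K : 'I_n -> E) :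
  jordan_frame J -> jordan_frame K -> m = n.
Proof.
move=> Jf Kf; apply/eqP; rewrite -(eqr_nat R).
have len k (L : 'I_k -> E) : jordan_frame L -> '[e, frame_weight J] = k%:R.
  move=> [Lp _ <-]; rewrite inner_suml (eq_bigr (fun=> 1)) => [|i _].
    by rewrite sumr_const card_ord.
  by rewrite frame_weight_primitive.
by rewrite -(len _ J)// -(len _ K).
Qed.

Lemma frame_length_rank n (J : 'I_n -> E) : jordan_frame J -> n = r.
Proof.
move=> Jf; rewrite /ej_rank; case: xgetP => [m _ [K /frame_length_unique]|].
  by move=> /(_ _ _ Jf).
by move=> /(_ n)[]; exists J.
Qed.

(** With the weight computed in the frame [K], its product with [K i] is a positive multiple of
    [K i]. *)
Lemma primitive_mul_weight_ge0 m n (J : 'I_m -> E) (K : 'I_n -> E) i d :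
  jordan_frame J -> jordan_frame K -> primitive_idempotent d ->
  0 <= '[K i ** d, frame_weight J].
Proof.
move=> Jf Kf dp; rewrite (frame_weight_unique Jf Kf) inner_mul.
have [Kp KK _] := Kf; rewrite /frame_weight jmul_sumr (bigD1 i)//= big1 ?addr0.
  rewrite jmulZr innerZr; case: (Kp i) => KiK _ _; rewrite KiK.
  rewrite mulr_ge0 ?invr_ge0 ?inner_ge0// idempotent_pair_inner_ge0//.
  by case: dp.
by move=> j ji; rewrite jmulZr KK ?scaler0// eq_sym.
Qed.

Definition frame_comb (J : 'I_r -> E) (u : 'cV[R]_r) : E := \sum_i u i 0 *: J i.

Lemma frame_comb_perm (J : 'I_r -> E) (u : 'cV[R]_r) (s : 'S_r) :
  frame_comb J u = frame_comb (J \o s) (row_perm s u).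
Proof.
rewrite /frame_comb (reindex_inj (@perm_inj _ s)).
by apply: eq_bigr => i _; rewrite mxE.
Qed.

Lemma frame_perm (J : 'I_r -> E) (s : 'S_r) :
  jordan_frame J -> jordan_frame (J \o s).
Proof.
move=> [Jp JJ Je]; split=> [i|i j ij|] /=; first exact: Jp.
  by rewrite JJ// (inj_eq perm_inj).
by rewrite -Je [RHS](reindex_inj (@perm_inj _ s)).
Qed.

Lemma sort_cV_perm n (u : 'cV[R]_n) : exists s : 'S_n, nonincreasing (row_perm s u).
Proof.
have [|y x z|s sP] := @sort_perm _ (fun a b : R => b <= a) _ (fun i => u i 0).
- by move=> a b; exact: le_total.
- by move=> xy yz; apply: le_trans yz xy.
- by exists s => i j /sP; rewrite !mxE.
Qed.

Lemma sorted_spectral_theorem x : exists (J : 'I_r -> E) (l : 'cV[R]_r),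
  [/\ nonincreasing l, jordan_frame J & x = frame_comb J l].
Proof.
have [n [J [l [Jf ->]]]] := spectral_theorem x.
have nr := frame_length_rank Jf; move: J l Jf; rewrite nr {nr n} => J l Jf.
have [s sl] := sort_cV_perm (\col_i l i).
exists (J \o s), (row_perm s (\col_i l i)); split=> //; first exact: frame_perm.
by rewrite -frame_comb_perm; apply: eq_bigr => i _; rewrite mxE.
Qed.

Lemma frame_comb_mul_weight (J : 'I_r -> E) a b n (L : 'I_n -> E) :
  jordan_frame J -> jordan_frame L ->
  '[frame_comb J a ** frame_comb J b, frame_weight L] = dotprod a b.
Proof.
move=> Jf Lf; rewrite frame_mul// inner_suml; apply: eq_bigr => i _.
by rewrite innerZl frame_weight_primitive ?mulr1//; case: Jf.
Qed.

(** The traces of the [J i ** K j] form a doubly stochastic matrix, since both frames sum to [e]. *)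
Lemma frame_comb_mul_weight_le (J K : 'I_r -> E) a b n (L : 'I_n -> E) :
  jordan_frame J -> jordan_frame K -> jordan_frame L ->
  nonincreasing a -> nonincreasing b ->
  '[frame_comb J a ** frame_comb K b, frame_weight L] <= dotprod a b.
Proof.
move=> Jf Kf Lf da db; have [[Jp _ Je] [Kp _ Ke]] := (Jf, Kf).
pose S i j := '[J i ** K j, frame_weight L].
rewrite [leLHS](_ : _ = \sum_i \sum_j a i 0 * b j 0 * S i j); last first.
  rewrite jmul_suml inner_suml; apply: eq_bigr => i _.
  rewrite jmul_sumr inner_suml; apply: eq_bigr => j _.
  by rewrite jmulZl jmulZr !innerZl mulrA.
apply: doubly_stochastic_le => // [i j|i|j].
- exact: primitive_mul_weight_ge0.
- by rewrite -inner_suml -jmul_sumr Ke jmul1r frame_weight_primitive.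
- by rewrite -inner_suml -jmul_suml Je ej_mul1 frame_weight_primitive.
Qed.

Lemma dotprod_eq0 n (u : 'cV[R]_n) : dotprod u u <= 0 -> u = 0.
Proof.
move=> u0; apply/matrixP => i j; rewrite ord1 mxE; apply/eqP.
rewrite -sqrf_eq0 expr2; apply/eqP.
have H : dotprod u u = 0.
  by apply/eqP; rewrite eq_le u0 sumr_ge0// => k _; rewrite -expr2 sqr_ge0.
by apply: (psumr_eq0P _ H) => // k _; rewrite -expr2 sqr_ge0.
Qed.

(** The trace inequality for the two representations reads [|a|^2 = |b|^2 <= <a, b>], so
    [|a - b|^2 <= 0]. *)
Lemma sorted_eigenvalues_unique (J K : 'I_r -> E) a b :
  jordan_frame J -> jordan_frame K -> nonincreasing a -> nonincreasing b ->
  frame_comb J a = frame_comb K b -> a = b.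
Proof.
move=> Jf Kf da db ab; apply/eqP; rewrite -subr_eq0; apply/eqP/dotprod_eq0.
have := frame_comb_mul_weight_le Jf Kf Jf da db.
have := frame_comb_mul_weight a a Jf Jf; have := frame_comb_mul_weight b b Kf Jf.
rewrite ab => -> aa; rewrite aa => le.
rewrite [leLHS](_ : _ = dotprod a a + dotprod b b - 2 * dotprod a b); first lra.
rewrite /dotprod -big_split mulr_sumr -sumrB; apply: eq_bigr => i _ /=.
by rewrite !mxE; ring.
Qed.

Lemma eigenvaluesP x : nonincreasing (eigenvalues x) /\
  exists2 J : 'I_r -> E, jordan_frame J & x = frame_comb J (eigenvalues x).
Proof.
rewrite /eigenvalues; case: xgetP => [l _ [? [J Jf xE]]|]; first by split=> //; exists J.
have [J [l [? ? ?]]] := sorted_spectral_theorem x.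
by move=> /(_ l)[]; split=> //; exists J.
Qed.

Lemma eigenvalues_sorted (J : 'I_r -> E) u : jordan_frame J -> nonincreasing u ->
  eigenvalues (frame_comb J u) = u.
Proof.
move=> Jf du; have [dl [K Kf]] := eigenvaluesP (frame_comb J u).
by move/esym/sorted_eigenvalues_unique; exact.
Qed.

Lemma eigenvalues_comb (J : 'I_r -> E) u : jordan_frame J ->
  exists s : 'S_r, eigenvalues (frame_comb J u) = row_perm s u.
Proof.
move=> Jf; have [s ds] := sort_cV_perm u; exists s.
by rewrite (frame_comb_perm _ _ s) eigenvalues_sorted//; apply: frame_perm.
Qed.

Lemma frame_exists : exists J : 'I_r -> E, jordan_frame J.
Proof. by have [_ [J Jf _]] := eigenvaluesP e; exists J. Qed.

(** Single eigenvalues are not linear in their argument; this shows that their sum is, whence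
    bilinearity. *)
Lemma trace_innerE n (L : 'I_n -> E) x y : jordan_frame L ->
  trace_inner x y = '[x ** y, frame_weight L].
Proof.
move=> Lf; rewrite /trace_inner; have [_ [K [Kp _ _] xyE]] := eigenvaluesP (x ** y).
rewrite {2}xyE inner_suml; apply: eq_bigr => i _.
by rewrite innerZl frame_weight_primitive// mulr1.
Qed.

Lemma trace_innerC x y : trace_inner x y = trace_inner y x.
Proof. by rewrite /trace_inner ej_mulC. Qed.

Lemma trace_inner_linearl (a : R) x y z :
  trace_inner (a *: x + y) z = a * trace_inner x z + trace_inner y z.
Proof.
have [L Lf] := frame_exists; rewrite !(trace_innerE _ _ Lf).
by rewrite jmulDl jmulZl innerDl innerZl.
Qed.

Lemma trace_inner_comb (J : 'I_r -> E) u v : jordan_frame J ->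
  trace_inner (frame_comb J u) (frame_comb J v) = dotprod u v.
Proof. by move=> Jf; rewrite (trace_innerE _ _ Jf) frame_comb_mul_weight. Qed.

Lemma trace_inner_self x :
  trace_inner x x = dotprod (eigenvalues x) (eigenvalues x).
Proof.
by have [_ [J Jf xE]] := eigenvaluesP x; rewrite {1 2}xE trace_inner_comb.
Qed.

Lemma trace_inner_le x y :
  trace_inner x y <= dotprod (eigenvalues x) (eigenvalues y).
Proof.
have [dx [J Jf xE]] := eigenvaluesP x; have [dy [K Kf yE]] := eigenvaluesP y.
by rewrite (trace_innerE _ _ Jf) {1}xE {1}yE frame_comb_mul_weight_le.
Qed.

Lemma trace_inner_eq0 x : trace_inner x x <= 0 -> x = 0.
Proof.
rewrite trace_inner_self => /dotprod_eq0 x0.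
have [_ [J _ ->]] := eigenvaluesP x.
by rewrite x0; apply: big1 => i _; rewrite mxE scale0r.
Qed.

End Frames.

(** * Regular subdifferentials *)

Section InnerProduct.
Variables (R : realType) (V : lmodType R) (ip : V -> V -> R).

(** The last clause packs nonnegativity and definiteness into one implication. *)
Definition inner_product := [/\ forall x y, ip x y = ip y x,
  forall a x y z, ip (a *: x + y) z = a * ip x z + ip y z &
  forall x, ip x x <= 0 -> x = 0].

Hypothesis ipP : inner_product.

Lemma ipC x y : ip x y = ip y x.
Proof. by case: ipP. Qed.
Lemma ipDl x y z : ip (x + y) z = ip x z + ip y z.
Proof. by case: ipP => _ lin _; rewrite -{1}[x]scale1r lin mul1r. Qed.
Lemma ip0l x : ip 0 x = 0.
Proof. by apply: (addIr (ip 0 x)); rewrite -ipDl !addr0 add0r. Qed.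
Lemma ipZl a x y : ip (a *: x) y = a * ip x y.
Proof. by case: ipP => _ lin _; rewrite -{1}[a *: x]addr0 lin ip0l addr0. Qed.
Lemma ipNl x y : ip (- x) y = - ip x y.
Proof. by rewrite -scaleN1r ipZl mulN1r. Qed.
Lemma ipDr x y z : ip x (y + z) = ip x y + ip x z.
Proof. by rewrite ipC ipDl !(ipC x). Qed.
Lemma ipZr a x y : ip x (a *: y) = a * ip x y.
Proof. by rewrite ipC ipZl ipC. Qed.
Lemma ipNr x y : ip x (- y) = - ip x y.
Proof. by rewrite ipC ipNl ipC. Qed.

Lemma ip_ge0 x : 0 <= ip x x.
Proof.
by case: ipP => _ _ pos; rewrite leNgt; apply/negP => /[dup] /ltW/pos ->; rewrite ip0l ltxx.
Qed.

Lemma ipnorm_ge0 x : 0 <= ipnorm ip x.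
Proof. exact: sqrtr_ge0. Qed.
Lemma ipnorm_sqr x : ipnorm ip x ^+ 2 = ip x x.
Proof. by rewrite sqr_sqrtr ?ip_ge0. Qed.
Lemma ipnorm0 : ipnorm ip 0 = 0.
Proof. by rewrite /ipnorm ip0l sqrtr0. Qed.
Lemma ipnorm_gt0 x : x != 0 -> 0 < ipnorm ip x.
Proof.
case: ipP => _ _ pos x0; rewrite sqrtr_gt0 ltNge; apply/negP => /pos/eqP.
exact/negP.
Qed.
Lemma ipnormB x y : ipnorm ip (x - y) = ipnorm ip (y - x).
Proof. by rewrite /ipnorm -opprB ipNl ipNr opprK. Qed.

Lemma cauchy_schwarz x y : ip x y <= ipnorm ip x * ipnorm ip y.
Proof.
have [->|/ipnorm_gt0 x0] := eqVneq x 0; first by rewrite ip0l ipnorm0 mul0r.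
have [->|/ipnorm_gt0 y0] := eqVneq y 0; first by rewrite ipC ip0l ipnorm0 mulr0.
have := ip_ge0 (ipnorm ip y *: x - ipnorm ip x *: y).
rewrite !(ipDl, ipDr, ipNl, ipNr, ipZl, ipZr) (ipC y x) -!ipnorm_sqr => H.
have xy0 := mulr_gt0 x0 y0; rewrite -(ler_pM2l xy0); nra.
Qed.

Lemma ipnormD x y : ipnorm ip (x + y) <= ipnorm ip x + ipnorm ip y.
Proof.
rewrite -(@ler_pXn2r _ 2%N) ?nnegrE ?addr_ge0 ?ipnorm_ge0//.
rewrite ipnorm_sqr !(ipDl, ipDr) (ipC y x) sqrrD !ipnorm_sqr.
by have := cauchy_schwarz x y; lra.
Qed.

Lemma regular_subdifferentialP (g : V -> R) u d :
  regular_subdifferential ip g u d <->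
  forall eps, 0 < eps -> exists2 del, 0 < del & forall v, ipnorm ip v < del ->
    - eps * ipnorm ip v <= g (u + v) - g u - ip d v.
Proof.
rewrite /regular_subdifferential /= /liminf_along; split=> [h eps eps0|h].
  have epsN : ((- eps)%:E < 0)%E by rewrite lte_fin oppr_lt0.
  have /ereal_sup_gt[_ [A [del /= del0 Adel] <-] epsA] := lt_le_trans epsN h.
  exists del => // v vdel.
  have [->|v0] := eqVneq v 0.
    by rewrite ipnorm0 mulr0 addr0 subrr ipC ip0l subr0.
  have nv := ipnorm_gt0 v0; rewrite -ler_pdivlMr// -lee_fin.
  apply: le_trans (ltW epsA) _.
  by apply: ereal_inf_lbound; exists v => //; apply: Adel => //=; rewrite subr0.
apply/lee_addgt0Pr => eps /[dup] eps0 /h[del del0 hdel].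
rewrite -leeBlDr// sub0e.
apply: le_trans (ereal_sup_ubound _); last first.
  exists [set v | v != 0 /\ ipnorm ip v < del] => //.
  by exists del => // v /=; rewrite subr0.
apply/ereal_infP => _ [v [v0 vdel] <-].
by rewrite lee_fin ler_pdivlMr ?ipnorm_gt0//; apply: hdel.
Qed.

Lemma ipcvg_ipnorm (u_ : nat -> V) u : ipcvg ip u_ u ->
  exists M, forall k, ipnorm ip (u_ k) <= M.
Proof.
move=> cu; have [M [_ HM]] := cvg_seq_bounded (cvgP _ cu).
exists (M + 1 + ipnorm ip u) => k.
rewrite -{1}[u_ k](subrK u) (le_trans (ipnormD _ _))// lerD2r.
by rewrite (le_trans (ler_norm _))// HM// ltrDl.
Qed.

End InnerProduct.

(** The sets lie in different spaces, so only norms are compared; an empty [D] is at distance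
    [+oo]. *)
Lemma ipdist_le (R : realType) (V W : lmodType R) (ipV : V -> V -> R)
    (ipW : W -> W -> R) (C : set V) (D : set W) :
  (forall d, D d -> exists2 c, C c & ipnorm ipV c <= ipnorm ipW d) ->
  (ipdist ipV 0%R C <= ipdist ipW 0%R D)%E.
Proof.
move=> CD; apply/ereal_infP => _ [d /CD[c Cc cd] <-].
apply: (@le_trans _ _ (ipnorm ipV c)%:E); last by rewrite lee_fin subr0.
by apply: ereal_inf_lbound; exists c; rewrite ?subr0.
Qed.

(** * Compactness and sorted perturbations in coordinates *)

Section Coordinates.
Variables (R : realType) (n : nat).
Implicit Types u v : 'cV[R]_n.

Lemma dotprod_inner_product : inner_product (@dotprod R n).
Proof.
split=> [x y|a x y z|x]; last exact: dotprod_eq0.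
  by apply: eq_bigr => i _; rewrite mulrC.
rewrite /dotprod mulr_sumr -big_split; apply: eq_bigr => i _ /=.
by rewrite !mxE mulrDl mulrA.
Qed.

Lemma dotprod_row_perm (s : 'S_n) u v :
  dotprod (row_perm s u) (row_perm s v) = dotprod u v.
Proof.
by rewrite /dotprod [RHS](reindex_inj (@perm_inj _ s)); apply: eq_bigr => i _; rewrite !mxE.
Qed.

Lemma coord_le_ipnorm u i : `|u i 0| <= ipnorm (@dotprod R n) u.
Proof.
rewrite -sqrtr_sqr ler_wsqrtr// /dotprod (bigD1 i)//= -expr2 lerDl.
by rewrite sumr_ge0// => j _; rewrite -expr2 sqr_ge0.
Qed.

Lemma coord_ipcvg (u_ : nat -> 'cV[R]_n) u :
  (forall i, u_ k i 0 @[k --> \oo] --> u i 0) -> ipcvg (@dotprod R n) u_ u.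
Proof.
move=> cu; rewrite /ipcvg /ipnorm /dotprod -[X in _ --> X]sqrtr0.
apply: continuous_cvg; first exact: sqrt_continuous.
rewrite [X in _ --> X](_ : 0 = \sum_(i < n) (u i 0 - u i 0) * (u i 0 - u i 0)); last first.
  by rewrite big1// => i _; rewrite subrr mul0r.
under eq_fun do under eq_bigr do rewrite !mxE.
apply: (cvg_big (@add_continuous R)) => i _.
by apply: cvgM; apply: cvgB => //; apply: cvg_cst.
Qed.

Lemma cvg_subsequence (T : topologicalType) (f : nat -> T) (phi : nat -> nat) (l : T) :
  (forall k, (k <= phi k)%N) -> f k @[k --> \oo] --> l ->
  f (phi k) @[k --> \oo] --> l.
Proof.
move=> phik; apply: cvg_comp; apply/cvgnyPge => A.
by exists A => // k /= /leq_trans; apply.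
Qed.

(** Bolzano-Weierstrass, extracting for one coordinate at a time. The bound [k <= phi k] makes [phi]
    tend to infinity and survives composition. *)
Lemma bounded_subsequence (d_ : nat -> 'cV[R]_n) (M : R) :
  (forall k, ipnorm (@dotprod R n) (d_ k) <= M) ->
  exists (phi : nat -> nat) l, (forall k, (k <= phi k)%N) /\
    ipcvg (@dotprod R n) (d_ \o phi) l.
Proof.
move=> dM.
suff /(_ n (leqnn n))[phi [phik cphi]] : forall m, (m <= n)%N ->
    exists phi : nat -> nat, (forall k, (k <= phi k)%N) /\
    forall i : 'I_n, (i < m)%N -> cvgn (fun k => d_ (phi k) i 0).
  exists phi, (\col_i lim ((d_ (phi k) i 0) @[k --> \oo])); split=> //.
  by apply: coord_ipcvg => i; rewrite mxE; apply: cphi.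
elim=> [_|m IHm mn]; first by exists id.
have [phi [phik cphi]] := IHm (ltnW mn).
have [|psi /unstable.mono_leq_infl psik cpsi] :=
    @bolzano_weierstrass _ (fun k => d_ (phi k) (Ordinal mn) 0).
  exists M; split; first exact: num_real.
  move=> x /ltW Mx k _ /=.
  exact: le_trans (coord_le_ipnorm _ _) (le_trans (dM _) Mx).
exists (phi \o psi); split=> [k|i].
  exact: leq_trans (psik k) (phik _).
rewrite ltnS leq_eqVlt => /orP[/eqP im|/cphi im].
  by rewrite (_ : i = Ordinal mn)//; apply: val_inj.
apply/cvg_ex; exists (lim ((d_ (phi k) i 0) @[k --> \oo])).
exact: (cvg_subsequence psik im).
Qed.

(** Strict gaps of [u] survive a small step and ties are ordered by [d]; [t] is the least of
    finitely many thresholds. *)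
Lemma small_perturbation u (d : 'cV[R]_n) : nonincreasing u ->
  (forall i j : 'I_n, (i <= j)%N -> u i 0 = u j 0 -> d j 0 <= d i 0) ->
  exists2 t, 0 < t & nonincreasing (u + t *: d).
Proof.
move=> du dd.
have /choice[t tP] : forall p : 'I_n * 'I_n, exists t, 0 < t /\
    forall s, 0 <= s <= t -> (p.1 <= p.2)%N ->
      u p.2 0 + s * d p.2 0 <= u p.1 0 + s * d p.1 0.
  move=> [i j] /=; have [ij|] := leqP i j; last by exists 1.
  have := du _ _ ij; rewrite le_eqVlt => /orP[/eqP uij|uij].
    exists 1; split=> // s /andP[s0 _] _.
    by rewrite uij lerD2l ler_wpM2l// dd.
  have D0 : 0 < 1 + `|d j 0 - d i 0| by rewrite ltr_pwDl.
  exists ((u i 0 - u j 0) / (1 + `|d j 0 - d i 0|)); split.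
    by rewrite divr_gt0// subr_gt0.
  move=> s /andP[s0]; rewrite ler_pdivlMr// => sD _.
  have := ler_norm (d j 0 - d i 0); nra.
exists (\big[Num.min/1]_p t p); first by apply: lt_bigmin => // p _; case: (tP p).
move=> i j ij; rewrite !mxE; have [_] := tP (i, j); apply=> //.
by rewrite bigmin_le andbT ltW// lt_bigmin// => p _; case: (tP p).
Qed.

End Coordinates.

(** * Subdifferentials of spectral functions *)

Section SpectralFunction.
Variables (R : realType) (E : euclideanJordanAlgebra R).
Local Notation r := (ej_rank E).
Local Notation tr := (@trace_inner R E).
Local Notation dot := (@dotprod R r).
Variable f : 'cV[R]_r -> R.
Hypothesis fsym : symmetric_fun f.
Local Notation F := (spectral_fun f).
Implicit Types (x y z D : E) (u v d : 'cV[R]_r) (J : 'I_r -> E).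

Lemma trace_inner_product : inner_product tr.
Proof.
split; [exact: trace_innerC|exact: trace_inner_linearl|exact: trace_inner_eq0].
Qed.

Lemma symmetric_row_perm (s : 'S_r) u : f (row_perm s u) = f u.
Proof. by rewrite row_permE fsym ?perm_mx_is_perm. Qed.

Lemma spectral_fun_comb J u : jordan_frame J -> F (frame_comb J u) = f u.
Proof.
by move=> Jf; have [s sE] := eigenvalues_comb u Jf; rewrite /spectral_fun sE symmetric_row_perm.
Qed.

Lemma frame_combD J u v : frame_comb J (u + v) = frame_comb J u + frame_comb J v.
Proof.
by rewrite /frame_comb -big_split; apply: eq_bigr => i _; rewrite mxE scalerDl.
Qed.

Lemma frame_combZ J a u : frame_comb J (a *: u) = a *: frame_comb J u.
Proof.
by rewrite /frame_comb scaler_sumr; apply: eq_bigr => i _; rewrite mxE scalerA.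
Qed.

Lemma frame_combB J u v : frame_comb J (u - v) = frame_comb J u - frame_comb J v.
Proof. by rewrite -scaleN1r frame_combD frame_combZ scaleN1r. Qed.

Lemma ipnorm_comb J u : jordan_frame J ->
  ipnorm tr (frame_comb J u) = ipnorm dot u.
Proof. by move=> Jf; rewrite /ipnorm trace_inner_comb. Qed.

(** After squaring, the norms of [x] and of its eigenvalue vector agree; the trace inequality
    compares the cross terms. *)
Lemma eigenvalues_lipschitz x y :
  ipnorm dot (eigenvalues x - eigenvalues y) <= ipnorm tr (x - y).
Proof.
apply: ler_wsqrtr; have tP := trace_inner_product.
have dP := dotprod_inner_product R r.
rewrite !(ipDl tP, ipDr tP, ipNl tP, ipNr tP) !(ipDl dP, ipDr dP, ipNl dP, ipNr dP).
rewrite (ipC tP y x) (ipC dP _ (eigenvalues x)) !trace_inner_self.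
by have := trace_inner_le x y; lra.
Qed.

Lemma lsc_spectral_fun : lsc tr F <-> lsc dot f.
Proof.
split=> fl u a.
  have [J Jf] := frame_exists E; rewrite -(spectral_fun_comb u Jf) => /fl[e /= e0 eF].
  exists e => // v /= vu; rewrite -(spectral_fun_comb v Jf); apply: eF => /=.
  by rewrite -frame_combB ipnorm_comb.
move=> /fl[e /= e0 ef]; exists e => // v /= vu; apply: ef => /=.
exact: le_lt_trans (eigenvalues_lipschitz _ _) vu.
Qed.

Lemma regular_subdifferential_row_perm (s : 'S_r) u d :
  regular_subdifferential dot f u d ->
  regular_subdifferential dot f (row_perm s u) (row_perm s d).
Proof.
have dP := dotprod_inner_product R r.
move/(regular_subdifferentialP dP) => h; apply/(regular_subdifferentialP dP).
move=> eps /h[del del0 hdel]; exists del => // v vdel.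
have vE : v = row_perm s (row_perm s^-1%g v) by apply/matrixP => i j; rewrite !mxE permK.
have nvE : ipnorm dot v = ipnorm dot (row_perm s^-1%g v).
  by rewrite /ipnorm {1 2}vE dotprod_row_perm.
rewrite [in dotprod _ v]vE dotprod_row_perm.
rewrite (_ : _ + v = row_perm s (u + row_perm s^-1%g v)); last first.
  by apply/matrixP => i j; rewrite !mxE permK.
by rewrite !symmetric_row_perm nvE; apply: hdel; rewrite -nvE.
Qed.

Lemma regular_subdifferential_comb_sorted J u d t : jordan_frame J ->
  nonincreasing u -> 0 < t -> nonincreasing (u + t *: d) ->
  regular_subdifferential dot f u d ->
  regular_subdifferential tr F (frame_comb J u) (frame_comb J d).
Proof.
have dP := dotprod_inner_product R r; have tP := trace_inner_product.
move=> Jf du t0 dud /(regular_subdifferentialP dP) h.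
apply/(regular_subdifferentialP tP) => eps eps0.
have [|del del0 hdel] := h (eps / 2); first by rewrite divr_gt0.
(* [del] serves the inequality for [f]; [t * eps] makes [|z|^2 / 2t] at most [eps / 2 * |z|]. *)
exists (Num.min del (t * eps)); first by rewrite lt_min del0 mulr_gt0.
move=> z; rewrite lt_min => /andP[zdel zt].
set x := frame_comb J u; set D := frame_comb J d.
have xu : eigenvalues x = u by rewrite eigenvalues_sorted.
set w := eigenvalues (x + z); pose k := w - u.
have wE : w = u + k by rewrite /k addrC subrK.
have kz : ipnorm dot k <= ipnorm tr z.
  rewrite /k -xu (le_trans (eigenvalues_lipschitz _ _))//.
  by rewrite addrC addKr.
clearbody k.
have := hdel k (le_lt_trans kz zdel).
rewrite (spectral_fun_comb u Jf) /spectral_fun -/w wE.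
suff : - (eps / 2) * ipnorm tr z <= dotprod d k - trace_inner D z.
  by have := ipnorm_ge0 dot k; nra.
have z0 : 0 <= ipnorm tr z by exact: sqrtr_ge0.
(* Expanded, this bounds [t (<d, k> - <D, z>)] below by [<x, z> - <u, k>], which equals
   [(|k|^2 - |z|^2) / 2] because [x + z] and [u + k] have equal norms. *)
have := trace_inner_le (frame_comb J (u + t *: d)) (x + z).
rewrite eigenvalues_sorted// -/w wE frame_combD frame_combZ -/x -/D.
have := trace_inner_self (x + z); rewrite -/w wE.
rewrite !(ipDl tP, ipDr tP, ipZl tP) !(ipDl dP, ipDr dP, ipZl dP).
rewrite !trace_inner_comb// (ipC tP z x) (ipC dP k u).
have := ip_ge0 dP k.
have : trace_inner z z <= t * eps * ipnorm tr z.
  by rewrite -(ipnorm_sqr tP) expr2 ler_wpM2r// ltW.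
move=> zz kk norm_xz ftvn; rewrite -(ler_pM2l t0); lra.
Qed.

Lemma regular_subdifferential_comb J u d : jordan_frame J ->
  regular_subdifferential dot f u d ->
  regular_subdifferential tr F (frame_comb J u) (frame_comb J d).
Proof.
move=> Jf h.
(* Decreasing lexicographic order: [u] gets sorted with ties broken by [d], as [small_perturbation]
   requires. *)
pose le (p q : R * R) := (q.1 < p.1) || ((p.1 == q.1) && (q.2 <= p.2)).
have [p q|q p k|s sP] := @sort_perm _ le _ (fun i => (u i 0, d i 0)).
- rewrite /le; case: (ltgtP p.1 q.1) => //= _; exact: le_total.
- rewrite /le => /orP[pq|/andP[/eqP-> pq]] /orP[qk|/andP[/eqP qk1 qk]].
  + by rewrite (lt_trans qk pq).
  + by rewrite -qk1 pq.
  + by rewrite qk.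
  + by rewrite qk1 eqxx (le_trans qk pq) orbT.
have du : nonincreasing (row_perm s u).
  by move=> i j /sP; rewrite !mxE /le /= => /orP[/ltW|/andP[/eqP ->]].
have [|t t0 dt] := @small_perturbation _ _ (row_perm s u) (row_perm s d) du.
  by move=> i j /sP; rewrite !mxE /le /= => /[swap] ->; rewrite ltxx eqxx.
rewrite (frame_comb_perm J u s) (frame_comb_perm J d s).
apply: regular_subdifferential_comb_sorted t0 dt _ => //; first exact: frame_perm.
exact: regular_subdifferential_row_perm.
Qed.

(** The adjoint of [frame_comb J]. *)
Definition frame_coord J D : 'cV[R]_r := \col_i trace_inner D (J i).

Lemma dotprod_frame_coord J D v :
  dotprod (frame_coord J D) v = trace_inner D (frame_comb J v).
Proof.
have tP := trace_inner_product.
rewrite /frame_comb (big_morph (trace_inner D) (ipDr tP D) (_ : _ = 0)).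
  by apply: eq_bigr => i _; rewrite mxE (ipZr tP) mulrC.
by rewrite (ipC tP) (ip0l tP).
Qed.

Lemma ipnorm_frame_coord J D : jordan_frame J ->
  ipnorm dot (frame_coord J D) <= ipnorm tr D.
Proof.
have dP := dotprod_inner_product R r; have tP := trace_inner_product.
move=> Jf; set d := frame_coord J D.
have [d0|d0] := eqVneq (ipnorm dot d) 0; first by rewrite d0 sqrtr_ge0.
have {}d0 : 0 < ipnorm dot d by rewrite lt_neqAle eq_sym d0 sqrtr_ge0.
rewrite -(ler_pM2r d0) -expr2 (ipnorm_sqr dP) [in leLHS]dotprod_frame_coord.
by rewrite -(ipnorm_comb d Jf); apply: cauchy_schwarz.
Qed.

(** Only perturbations diagonal in the frame are tested; on them [F] reduces to [f] and norms
    agree. *)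
Lemma regular_subdifferential_coord J u D : jordan_frame J ->
  regular_subdifferential tr F (frame_comb J u) D ->
  regular_subdifferential dot f u (frame_coord J D).
Proof.
have dP := dotprod_inner_product R r; have tP := trace_inner_product.
move=> Jf /(regular_subdifferentialP tP) h; apply/(regular_subdifferentialP dP).
move=> eps /h[del del0 hdel]; exists del => // v vdel.
rewrite dotprod_frame_coord -(ipnorm_comb v Jf).
rewrite -(spectral_fun_comb u Jf) -(spectral_fun_comb (u + v) Jf) frame_combD.
by apply: hdel; rewrite ipnorm_comb.
Qed.

Lemma subdifferential_comb J u d : jordan_frame J -> subdifferential dot f u d ->
  subdifferential tr F (frame_comb J u) (frame_comb J d).
Proof.
move=> Jf [u_ [d_ [cu cd cf sub]]].
exists (frame_comb J \o u_), (frame_comb J \o d_); split=> /=.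
- by rewrite /ipcvg; under eq_fun do rewrite /= -frame_combB ipnorm_comb//.
- by rewrite /ipcvg; under eq_fun do rewrite /= -frame_combB ipnorm_comb//.
- by rewrite spectral_fun_comb//; under eq_fun do rewrite /= spectral_fun_comb//.
- by move=> k; apply: regular_subdifferential_comb.
Qed.

(** The frames vary along the sequence and may not converge, but the coordinate vectors of the
    [D_ k] are bounded, so a subsequence has a limit. *)
Lemma subdifferential_eigenvalues x D : subdifferential tr F x D ->
  exists2 d, subdifferential dot f (eigenvalues x) d &
             ipnorm dot d <= ipnorm tr D.
Proof.
have dP := dotprod_inner_product R r; have tP := trace_inner_product.
move=> [x_ [D_ [cx cD cF sub]]].
have /choice[J_ JP] : forall k, exists J : 'I_r -> E, jordan_frame J /\
    x_ k = frame_comb J (eigenvalues (x_ k)).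
  by move=> k; have [_ [J Jf xE]] := eigenvaluesP (x_ k); exists J.
pose d_ k := frame_coord (J_ k) (D_ k).
have dD k : ipnorm dot (d_ k) <= ipnorm tr (D_ k).
  by apply: ipnorm_frame_coord; case: (JP k).
have [M DM] := ipcvg_ipnorm tP cD.
have [phi [d [phik cd]]] := bounded_subsequence (fun k => le_trans (dD k) (DM k)).
exists d.
  exists (fun k => eigenvalues (x_ (phi k))), (d_ \o phi); split=> //.
  - apply: (@squeeze_cvgr _ _ _ _ (fun=> 0) (fun k => ipnorm tr (x_ (phi k) - x))).
    + by apply: nearW => k; rewrite sqrtr_ge0 eigenvalues_lipschitz.
    + exact: cvg_cst.
    + exact: cvg_subsequence phik cx.
  - exact: cvg_subsequence phik cF.
  - move=> k /=; have [Jf xE] := JP (phi k).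
    by apply: regular_subdifferential_coord => //; rewrite -xE.
(* By the triangle inequality each term of this sequence bounds [|d|]. *)
have cvg_bound : (ipnorm dot (d_ (phi k) - d) + (ipnorm tr (D_ (phi k) - D) + ipnorm tr D))
    @[k --> \oo] --> ipnorm tr D.
  rewrite -[X in _ --> X]add0r -[X in _ --> _ + X]add0r.
  apply: cvgD => //; apply: cvgD; last exact: cvg_cst.
  exact: cvg_subsequence phik cD.
rewrite -(cvg_lim (@Rhausdorff R) cvg_bound); apply: limr_ge.
  by apply/cvg_ex; exists (ipnorm tr D).
apply: nearW => k; rewrite -{1}[d](subrK (d_ (phi k))).
rewrite (le_trans (ipnormD dP _ _))// (ipnormB dP) lerD2l (le_trans (dD _))//.
by rewrite -{1}[D_ _](subrK D) (ipnormD tP).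
Qed.

Lemma dom_subdifferential_spectral x :
  dom_subdifferential tr F x <-> dom_subdifferential dot f (eigenvalues x).
Proof.
split=> -[d dP].
  by have [d' d'P _] := subdifferential_eigenvalues dP; exists d'.
have [_ [J Jf xE]] := eigenvaluesP x.
by exists (frame_comb J d); rewrite xE; apply: subdifferential_comb.
Qed.

Lemma ipdist_comb J u : jordan_frame J ->
  (ipdist tr 0%R (subdifferential tr F (frame_comb J u)) <=
   ipdist dot 0%R (subdifferential dot f u))%E.
Proof.
move=> Jf; apply: ipdist_le => d du; exists (frame_comb J d).
  exact: subdifferential_comb.
by rewrite ipnorm_comb.
Qed.

Lemma ipdist_eigenvalues x :
  (ipdist dot 0%R (subdifferential dot f (eigenvalues x)) <=
   ipdist tr 0%R (subdifferential tr F x))%E.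
Proof. by apply: ipdist_le => D; exact: subdifferential_eigenvalues. Qed.

(** Allows multiplying a comparison of possibly infinite distances by the derivative of [psi]. *)
Lemma desingularizing_derive_ge0 (psi : R -> R) (nu : \bar R) (a b : R) :
  desingularizing psi nu -> (a%:E < b%:E < a%:E + nu)%E ->
  (0 <= (derive1 psi (b - a))%:E)%E.
Proof.
move=> [_ _ _ _ psi'] /andP[ab bnu]; rewrite lee_fin ltW// psi'//; split.
  by rewrite subr_gt0 -lte_fin.
by rewrite EFinB lteBlDl.
Qed.

Lemma KL_with_spectral x (psi : R -> R) (nu : \bar R) :
  KL_with tr F x psi nu <-> KL_with dot f (eigenvalues x) psi nu.
Proof.
have [_ [J Jf xE]] := eigenvaluesP x.
split=> -[fl fdom nu0 psiP [U [e /= e0 eU] HU]]; split=> //.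
- exact/lsc_spectral_fun.
- exact/dom_subdifferential_spectral.
(* Pull back along the isometry given by a frame that diagonalizes [x]; such [v] may be unsorted. *)
- exists [set v | U (frame_comb J v)].
    exists e => // v /= ve; apply: eU => /=.
    by rewrite [in ipnorm _ _]xE -frame_combB ipnorm_comb.
  move=> v /= /HU; rewrite spectral_fun_comb// => Hv vnu.
  apply: le_trans (Hv vnu) _; apply: lee_wpmul2l; last exact: ipdist_comb.
  exact: desingularizing_derive_ge0 psiP vnu.
- exact/lsc_spectral_fun.
- exact/dom_subdifferential_spectral.
(* Pull back along the 1-Lipschitz eigenvalue map. *)
- exists [set y | U (eigenvalues y)].
    exists e => // y /= ye; apply: eU => /=.
    exact: le_lt_trans (eigenvalues_lipschitz _ _) ye.
  move=> y /= /HU Hy ynu; apply: le_trans (Hy ynu) _.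
  apply: lee_wpmul2l; last exact: ipdist_eigenvalues.
  exact: desingularizing_derive_ge0 psiP ynu.
Qed.

End SpectralFunction.

Theorem theorem28 (R : realType) (E : euclideanJordanAlgebra R)
    (f : 'cV[R]_(ej_rank E) -> R) (fsym : symmetric_fun f) (x : E) :
  [/\ KL_property (@trace_inner R E) (spectral_fun f) x <->
        KL_property (@dotprod R (ej_rank E)) f (eigenvalues x),
      forall (psi : R -> R) (nu : \bar R),
        KL_with (@trace_inner R E) (spectral_fun f) x psi nu <->
        KL_with (@dotprod R (ej_rank E)) f (eigenvalues x) psi nu &
      forall alpha : R,
        KL_exponent (@trace_inner R E) (spectral_fun f) x alpha <->
        KL_exponent (@dotprod R (ej_rank E)) f (eigenvalues x) alpha].
Proof.
have KL psi nu := KL_with_spectral fsym x psi nu.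
split=> [|//|alpha].
  by split=> -[psi [nu /KL H]]; exists psi, nu.
by split=> -[c [nu [c0 /KL H]]]; exists c, nu.
Qed.
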